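(* Let $k$ be an algebraically closed field, $n\ge 1$, and let $L=(L_i)_{1\le i\le n^2}\in\mathcal{A}(k^n)$ be an admissible polynomial operator curve such that $\Sigma(L)=\bar{\Sigma}(L)\neq k$. Then $$\sum_{\lambda\in\Sigma(L)}\mathfrak{m}[L,\lambda]=\sum_{\lambda\in\Sigma(L)}i(\mathcal{S}(k^n),L(k);L(\lambda))=mn,$$ where $m:=\max_i\deg(L_i(\lambda))$.
   Context: $\mathcal{L}(k^n)$ is the space of linear maps $k^n\to k^n$, identified with $n\times n$ matrices and with affine space $\operatorname{Spec}k[x_1,\dots,x_{n^2}]$ (the $x_i$ being the matrix entries). $\mathcal{S}(k^n)$ is the subscheme of non-invertible maps, $\operatorname{Spec}(k[x_1,\dots,x_{n^2}]/\mathfrak{D})$ with $\mathfrak{D}=\langle\det(x_1,\dots,x_{n^2})\rangle$. $\mathcal{P}(k^n)$ is the set of polynomial operator curves $L(\lambda)=\sum_{i=0}^m T_i\lambda^i$ with $T_i\in\mathcal{L}(k^n)$, $T_m\ne 0$. Write $L(\lambda)=(L_i(\lambda))_{1\le i\le n^2}$ for its entries, $L_i\in k[\lambda]$. The curve $L$ is admissible, $L\in\mathcal{A}(k^n)$, if the $k$-subalgebra generated by the entries is everything: $k[L_1(\lambda),\dots,L_{n^2}(\lambda)]=k[\lambda]$. The spectrum is $\Sigma(L)=\{\lambda\in k:\det(L(\lambda))=0\}$, and for $\lambda_0\in\Sigma(L)$ the algebraic multiplicity is $\mathfrak{m}[L,\lambda_0]=\operatorname{ord}_{\lambda=\lambda_0}\det(L(\lambda))$.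 Projective spectrum: let $d=\max_i\deg(L_i)$, $\mathbb{P}\mathcal{L}(k^n)=\operatorname{Proj}k[x_0,x_1,\dots,x_{n^2}]$ and $$\bar L:\mathbb{P}^1(k)\to\mathbb{P}\mathcal{L}(k^n),\quad [\lambda:\mu]\mapsto[\mu^d:\mu^dL_1(\lambda/\mu):\dots:\mu^dL_{n^2}(\lambda/\mu)].$$ Then $\bar\Sigma(L)=\Sigma(L)\cup\Sigma_\infty(L)$, where $\Sigma_\infty(L)=\emptyset$ if $\det(\bar L([\lambda:0]))\ne 0$ and $\Sigma_\infty(L)=\{\infty\}$ if $\det(\bar L([\lambda:0]))=0$; here $\det$ is the homogeneous polynomial $\det(x_1,\dots,x_{n^2})$ evaluated on the coordinates $x_1,\dots,x_{n^2}$ of the point $\bar L([\lambda:0])$. $L(k)$ denotes the image of $L$ as the closed subscheme $\operatorname{Spec}(k[x_1,\dots,x_{n^2}]/\mathfrak{I})$, where $\mathfrak{I}=\ker(\varphi)$ and $\varphi:k[x_1,\dots,x_{n^2}]\to k[\lambda]$, $x_i\mapsto L_i(\lambda)$. Intersection multiplicity (Serre): for subvarieties $X_1,X_2$ of a smooth variety $X$ intersecting properly, and $c$ an isolated point of $X_1\cap X_2$, with ideals $\mathfrak{P}_{X_1},\mathfrak{P}_{X_2}$ in the local ring $\mathcal{O}_{c,X}$, $$i(X_1,X_2;c)=\sum_{i=0}^{\dim X}(-1)^i\,\ell_{\mathcal{O}_{c,X}}\operatorname{Tor}_i^{\mathcal{O}_{c,X}}(\mathcal{O}_{c,X}/\mathfrak{P}_{X_1},\mathcal{O}_{c,X}/\mathfrak{P}_{X_2}),$$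 where $\ell$ is module length. When $X_1,X_2$ are Cohen--Macaulay this equals $\ell_{\mathcal{O}_{c,X}}(\mathcal{O}_{c,X}/(\mathfrak{P}_{X_1}+\mathfrak{P}_{X_2}))$. Here $X=\mathcal{L}(k^n)$. *)

(* Defs.v *)
(* MathComp, with the classical layer (boolp, sets, sums over finite sets) of
   MathComp-Analysis. *)
From HB Require Import structures.
From mathcomp Require Import all_boot all_order all_algebra.
From mathcomp Require Import fraction mpoly.
From mathcomp Require Import boolp classical_sets cardinality fsbigop.

Set Implicit Arguments.
Unset Strict Implicit.
Unset Printing Implicit Defensive.

Import GRing.Theory.
Local Open Scope ring_scope.
Local Open Scope classical_set_scope.

Notation "x %:F" := (FracField.tofrac x) : ring_scope.

Section ModuleLength.
Variables (A : comNzRingType) (V : lmodType A).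

(* Submodules of Z / B are submodules of V between B and Z. *)
Definition has_chain (Z B : set V) (l : nat) : Prop :=
  exists C : nat -> {pred V},
    [/\ forall i, (i <= l)%N -> GRing.submod_closed (C i),
        forall v, B v -> v \in C 0%N,
        forall v, v \in C l -> Z v
      & forall i, (i < l)%N ->
          {subset C i <= C i.+1} /\ ~ {subset C i.+1 <= C i}].

Definition is_length (Z B : set V) (l : nat) : Prop :=
  has_chain Z B l /\ forall l', has_chain Z B l' -> (l' <= l)%N.

Definition finite_length (Z B : set V) : Prop := exists l, is_length Z B l.

(* The length of Z / B; by convention 0 when it is not finite. *)
Definition mod_length (Z B : set V) : nat := xget 0%N [set l | is_length Z B l].

End ModuleLength.

Section Tor.
Variable A : comNzRingType.

(* ... -> A^(rk 2) -> A^(rk 1) -> A^(rk 0) -> A, where maps act on row vectors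
   by right multiplication.  After composing the last map with A -> A / I this
   is a candidate for a free resolution of A / I. *)
Record free_seq := FreeSeq {
  rk : nat -> nat;
  diff : forall i, 'M[A]_(rk i.+1, rk i);
  aug : 'cV[A]_(rk 0)
}.

Definition free_resolution (I : set A) (F : free_seq) : Prop :=
  [/\ forall x, exists v : 'rV_(rk F 0), I (x - (v *m aug F) 0 0),
      forall v : 'rV_(rk F 0),
        I ((v *m aug F) 0 0) <-> exists w, v = w *m diff F 0
    & forall i (v : 'rV_(rk F i.+1)),
        v *m diff F i = 0 <-> exists w, v = w *m diff F i.+1].

Definition zero_seq : free_seq :=
  @FreeSeq (fun=> 0%N) (fun=> 0) 0.

(* A chosen resolution of A / I by free modules of finite rank; one exists
   whenever A is Noetherian and I is an ideal. *)
Definition resolution (I : set A) : free_seq :=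
  if pselect (exists F, free_resolution I F) is left e
  then projT1 (cid e) else zero_seq.

(* F_i (x) A/J = (A/J)^(rk i) = A^(rk i) / J A^(rk i); the cycles and boundaries
   of F (x) A/J are represented by their preimages in A^(rk i). *)
Definition tensor_cycles (F : free_seq) (J : set A) (i : nat) :
    set 'rV[A]_(rk F i) :=
  match i with
  | 0 => setT
  | i'.+1 => [set v | forall j, J ((v *m diff F i') 0 j)]
  end.

Definition tensor_boundaries (F : free_seq) (J : set A) (i : nat) :
    set 'rV[A]_(rk F i) :=
  [set v | exists w, forall j, J ((v - w *m diff F i) 0 j)].

Arguments tensor_cycles F J i : clear implicits.
Arguments tensor_boundaries F J i : clear implicits.

(* Tor_i(A/I, A/J) = H_i(F (x) A/J), for F the chosen resolution of A/I. *)
Definition tor_length (I J : set A) (i : nat) : nat :=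
  mod_length (tensor_cycles (resolution I) J i)
             (tensor_boundaries (resolution I) J i).

Definition tor_finite_length (I J : set A) (i : nat) : Prop :=
  finite_length (tensor_cycles (resolution I) J i)
                (tensor_boundaries (resolution I) J i).

End Tor.

Section LocalRing.
Variables (k : fieldType) (N : nat) (c : 'I_N -> k).

Definition regular_at : {pred {fraction {mpoly k[N]}}} :=
  fun x => `[< exists p q : {mpoly k[N]},
                 q.@[c] != 0 /\ x = p%:F / q%:F >].

Fact regular_at_subring : subring_closed regular_at.
Proof.
have nz (q : {mpoly k[N]}) : q.@[c] != 0 -> q%:F != 0.
  by move=> qc; rewrite tofrac_eq0; apply: contraNneq qc => ->; rewrite meval0.
split=> [|x y|x y].
- by apply/asboolP; exists 1, 1; rewrite meval1 oner_neq0 tofrac1 divr1.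
- move=> /asboolP[p [q [qc ->]]] /asboolP[r [s [sc ->]]].
  apply/asboolP; exists (p * s - r * q), (q * s).
  rewrite mevalM mulf_neq0 //; split=> //.
  rewrite tofracB !tofracM -mulNr addf_div ?nz //.
  by rewrite mulNr.
- move=> /asboolP[p [q [qc ->]]] /asboolP[r [s [sc ->]]].
  apply/asboolP; exists (p * r), (q * s).
  by rewrite mevalM mulf_neq0 // !tofracM mulf_div.
Qed.

HB.instance Definition _ :=
  GRing.isSubringClosed.Build _ regular_at regular_at_subring.

(* The local ring of affine N-space at the closed point c. *)
Record local_ring := LocalRing {
  frac_of_local :> {fraction {mpoly k[N]}};
  _ : frac_of_local \in regular_at
}.

HB.instance Definition _ := [isSub for frac_of_local].
HB.instance Definition _ := [Choice of local_ring by <:].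
HB.instance Definition _ := [SubChoice_isSubComNzRing of local_ring by <:].

Definition ext_ideal (I : set {mpoly k[N]}) : set local_ring :=
  [set x | exists p q : {mpoly k[N]},
     [/\ I p, q.@[c] != 0 & val x = p%:F / q%:F]].

End LocalRing.

Arguments ext_ideal {k N} c I.

(* Serre's intersection multiplicity at c of the closed subschemes of affine
   N-space with ideals I1 and I2. *)
Definition intersection_mult (k : fieldType) (N : nat)
    (I1 I2 : set {mpoly k[N]}) (c : 'I_N -> k) : int :=
  \sum_(i < N.+1)
    (-1) ^+ i * (tor_length (ext_ideal c I1) (ext_ideal c I2) i)%:Z.

Definition intersection_mult_finite (k : fieldType) (N : nat)
    (I1 I2 : set {mpoly k[N]}) (c : 'I_N -> k) : Prop :=
  forall i, (i <= N)%N ->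
    tor_finite_length (ext_ideal c I1) (ext_ideal c I2) i.

Section OperatorCurves.
Variables (k : fieldType) (n : nat).

Implicit Type L : 'M[{poly k}]_n.

(* The n * n coordinates are the entries of the matrix in row-major order. *)
Definition generic_mx : 'M[{mpoly k[n * n]}]_n := vec_mx (\row_i 'X_i).

Definition point_of_mx (T : 'M[k]_n) : 'I_(n * n) -> k := fun i => mxvec T 0 i.

Definition singular_ideal : set {mpoly k[n * n]} :=
  [set p | exists q, p = q * \det generic_mx].

Definition admissible L : Prop :=
  forall B : {pred {poly k}}, GRing.subalg_closed B ->
    (forall i j, L i j \in B) -> forall p, p \in B.

Definition curve_at L (x : k) : 'M[k]_n := map_mx (horner^~ x) L.

Definition spectrum L : set k := [set x | \det (curve_at L x) = 0].

Definition alg_mult L (x : k) : nat := mup x (\det L).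

Definition curve_degree L : nat := \max_i \max_j (size (L i j)).-1.

(* Homogeneous coordinates of the image of [a : b]: the coordinate x_0,
   followed by the matrix of the remaining ones. *)
Definition proj_curve L (a b : k) : k * 'M[k]_n :=
  let d := curve_degree L in
  (b ^+ d,
   \matrix_(i, j) \sum_(l < d.+1) (L i j)`_l * a ^+ l * b ^+ (d - l)).

(* A subset of the projective line, with Some x for [x : 1] and None for
   infinity = [1 : 0]. *)
Definition proj_spectrum L : set (option k) :=
  [set z | if z is Some x then spectrum L x
           else \det (proj_curve L 1 0).2 = 0].

Definition curve_comorphism L : {mpoly k[n * n]} -> {poly k} :=
  mmap polyC (fun i => mxvec L 0 i).

Definition curve_ideal L : set {mpoly k[n * n]} :=
  [set p | curve_comorphism L p = 0].

End OperatorCurves.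

(* Main.v *)
(* Multiplication by the equation a of S(k^n) resolves O / (a) in the local ring
   O at L(x), so the Tor modules against O / J, J the ideal of the curve, are
   O / (a, J) in degree 0 and the a-torsion of O / J in degree 1.  Admissibility
   makes the comorphism surjective, hence O / J is k[lambda] localised at x, and
   a becomes det L, which is nonzero: the torsion vanishes, and O / (a, J) is
   uniserial of length ord_x (det L).  Finally det L has degree m n, because its
   coefficient of degree m n is the determinant of L at infinity. *)
Require Import Defs.
From mathcomp Require Import all_boot all_order all_algebra.
From mathcomp Require Import fraction mpoly.
From mathcomp Require Import ring.
From mathcomp Require Import boolp classical_sets cardinality fsbigop.

Import GRing.Theory.
Local Open Scope ring_scope.
Local Open Scope classical_set_scope.

Set Implicit Arguments.
Unset Strict Implicit.
Unset Printing Implicit Defensive.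

(** * Length of a quotient module *)

Section Length.
Variables (A : comNzRingType) (V : lmodType A).
Implicit Types (Z B : set V).

Lemma mod_lengthP Z B l : is_length Z B l -> mod_length Z B = l.
Proof.
move=> hl; apply: xget_subset1 => // a b [ca ua] [cb ub].
by apply/eqP; rewrite eqn_leq ub ?ua.
Qed.

(** [C] serves as the one-term chain. A longer chain would need a strict inclusion, but its last
    term lies in [Z], hence in [B], hence in its first term. *)
Lemma is_length0 Z B (C : {pred V}) : GRing.submod_closed C ->
  (forall v, B v -> v \in C) -> (forall v, v \in C -> Z v) ->
  (forall v, Z v -> B v) -> is_length Z B 0.
Proof.
move=> subC BC CZ ZB; split; first by exists (fun=> C); split.
case=> [//|l] [D [_ BD DZ mono]].
have [_] := mono 0%N (ltn0Sn l); case=> x xD.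
have DS : forall i, (i <= l.+1)%N -> {subset D (l.+1 - i)%N <= D l.+1}.
  elim=> [|i IH] il y; first by rewrite subn0.
  move=> yD; apply: IH; first exact: ltnW.
  have -> : (l.+1 - i)%N = (l.+1 - i.+1).+1 by rewrite subnSK.
  by apply: (proj1 (mono _ _)) => //; rewrite subSS ltnS leq_subr.
by apply/BD/ZB/DZ/(DS l) => //; rewrite subSn // subnn.
Qed.

(* The D i are then the only submodules containing B: V / B is uniserial. *)
Lemma is_length_uniserial B m (D : nat -> {pred V}) :
  (forall i, GRing.submod_closed (D i)) ->
  (forall i, {subset D i.+1 <= D i}) ->
  (forall v, v \in D 0%N) ->
  (forall v, B v <-> v \in D m) ->
  (forall i, (i < m)%N -> exists2 x, x \in D i & x \notin D i.+1) ->
  (forall i x y, (i < m)%N -> x \notin D i.+1 -> y \in D i ->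
     exists r, B (y - r *: x)) ->
  is_length setT B m.
Proof.
move=> subD decD D0 BD strictD uniD; split.
  exists (fun i => D (m - i)%N); split=> // [v /BD|i im]; first by rewrite subn0.
  rewrite -subnSK //; split; first exact: decD.
  have [|x xD xnD] := strictD (m - i.+1)%N; first by rewrite subnSK ?leq_subr.
  by move=> /(_ _ xD); apply/negP.
move=> l [C [subC BC _ mono]].
(* Each strict inclusion in [C] climbs at least one step of [D]: a new element [x] of [C i.+1] lies
   outside [D (m - i)], so by [uniD] it generates [D (m - i.+1)] modulo [B]. *)
suff : forall i, (i <= l)%N -> (i <= m)%N /\ {subset D (m - i)%N <= C i}.
  by move=> /(_ l (leqnn l)) [].
elim=> [|i IH] il; first by rewrite subn0; split=> // x /BD/BC.
have [im DC] := IH (ltnW il).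
have [CC /existsNP[x /not_implyP[xC /negP xnC]]] := mono i il.
have xnD : x \notin D (m - i)%N by apply: contra xnC; apply: DC.
have lt_im : (i < m)%N.
  rewrite ltn_neqAle im andbT; apply: contraNneq xnD => ->.
  by rewrite subnn.
split=> // y yD.
have [|||r /BC yrx] := uniD (m - i.+1)%N x y; rewrite ?subnSK ?leq_subr //.
have BCi : forall j, (j <= i.+1)%N -> {subset C 0%N <= C j}.
  elim=> [_ z //|j IHj ji z zC].
  by apply: (proj1 (mono j (leq_trans ji il))); apply: IHj => //; apply: ltnW.
have [_ linC] := subC i.+1 il.
by rewrite -(subrK (r *: x) y) addrC linC // BCi.
Qed.

End Length.

(** * Tor of the quotient by a principal ideal with regular generator *)

Section TorPrincipal.
Variables (A : comNzRingType) (a : A) (I J : set A).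
Hypotheses (IE : forall x, I x <-> exists y, x = y * a)
  (a_reg : forall y, y * a = 0 -> y = 0).
Hypotheses (J0 : J 0) (JD : forall x y, J x -> J y -> J (x + y))
  (JM : forall r x, J x -> J (r * x)).

(** The chosen resolution is a genuine one as soon as some resolution exists, and the Koszul complex
    of the regular element [a] is one. *)
Lemma resolution_principal : free_resolution I (resolution I).
Proof.
rewrite /resolution; case: pselect => [e|]; first exact: projT2 (cid e).
(* The ranks are 1, 1, 0, 0, ..., so [const_mx a] is the 1 x 1 matrix of [a] in degree 0 and an
   empty matrix above. *)
case; exists (@FreeSeq A (fun i => nat_of_bool (i < 2)%N) (fun i => const_mx a)
  (const_mx 1)); split=> [x|v|i v] /=.
- exists (const_mx x); rewrite !mxE big_ord1 !mxE mulr1 subrr.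
  by apply/IE; exists 0; rewrite mul0r.
- rewrite !mxE big_ord1 !mxE mulr1; split.
    move=> /IE[y vE]; exists (const_mx y).
    by apply/rowP=> j; rewrite !mxE big_ord1 !mxE ord1.
  by case=> w ->; apply/IE; exists (w 0 0); rewrite !mxE big_ord1 !mxE.
- split=> [vz|[w ->]]; last first.
    by apply/rowP=> j; rewrite -mulmxA !mxE big_ord0.
  exists 0; rewrite mul0mx; case: i v vz => [|i] v vz /=.
    apply/rowP => j; rewrite !mxE ord1; apply: a_reg.
    by have /rowP/(_ 0) := vz; rewrite !mxE big_ord1 !mxE.
  by apply/rowP => j; have := ltn_ord j.
Qed.

Let F := resolution I.

Lemma diff_aug_mem (w : 'rV_(rk F 1)) : I ((w *m diff F 0 *m aug F) 0 0).
Proof. by have [_ + _] := resolution_principal => ->; exists w. Qed.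

Lemma diff_diff i : diff F i.+1 *m diff F i = 0.
Proof.
apply/row_matrixP => r; rewrite row0 row_mul; have [_ _ ex] := resolution_principal.
by apply/ex; exists (delta_mx 0 r); rewrite rowE.
Qed.

(** Exactness applied to each row: this is how maps out of free modules are lifted below. *)
Lemma mx_lift i p (X : 'M_(p, rk F i.+1)) :
  X *m diff F i = 0 -> exists Y, X = Y *m diff F i.+1.
Proof.
move=> X0; have [_ _ ex] := resolution_principal.
have /choice[f fE] : forall r, exists w, row r X = w *m diff F i.+1.
  by move=> r; apply/ex; rewrite -row_mul X0 row0.
by exists (\matrix_r f r); apply/row_matrixP=> r; rewrite row_mul rowK.
Qed.

Lemma mx_lift0 p (X : 'M_(p, rk F 0)) :
  (forall r, I ((X *m aug F) r 0)) -> exists Y, X = Y *m diff F 0.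
Proof.
move=> XI; have [_ ex _] := resolution_principal.
have /choice[f fE] : forall r, exists w, row r X = w *m diff F 0.
  by move=> r; apply/ex; rewrite -row_mul mxE.
by exists (\matrix_r f r); apply/row_matrixP=> r; rewrite row_mul rowK.
Qed.

Lemma mx_divr p (X : 'cV_p) : (forall r, I (X r 0)) -> exists Y, X = a *: Y.
Proof.
move=> XI; have /choice[f fE] : forall r, exists y, X r 0 = y * a.
  by move=> r; apply/IE.
by exists (\col_r f r); apply/colP=> r; rewrite !mxE fE mulrC.
Qed.

Lemma scale_reg p q (X : 'M_(p, q)) : a *: X = 0 -> X = 0.
Proof.
move=> aX; apply/matrixP=> i j; rewrite mxE; apply: a_reg.
by move/matrixP/(_ i j): aX; rewrite !mxE mulrC.
Qed.

(* A contracting homotopy of F, up to a map factoring through the Koszul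
   complex A --a--> A; f and g are the comparison maps in degree 1. *)
Lemma homotopy_koszul :
  exists (u : 'rV_(rk F 0)) (f : 'cV_(rk F 1)) (g : 'rV_(rk F 1))
         (s : forall i, 'M_(rk F i, rk F i.+1)),
    [/\ I (1 - (u *m aug F) 0 0),
        diff F 0 *m aug F = a *: f,
        1%:M - f *m g = diff F 0 *m s 0%N + s 1%N *m diff F 1 &
        forall i, 1%:M = diff F i.+1 *m s i.+1 + s i.+2 *m diff F i.+2].
Proof.
have [/(_ 1)[u uI] _ _] := resolution_principal.
(* In degrees 0 and 1, [aug F] and [f] map [F] to the Koszul complex, while [u] and [g] map back. *)
have [r|f fE] := @mx_divr _ (diff F 0 *m aug F).
  have := diff_aug_mem (delta_mx 0 r).
  by rewrite -mulmxA -rowE mxE.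
have [r|g gE] := @mx_lift0 _ (a *: u).
  by apply/IE; exists ((u *m aug F) 0 0); rewrite ord1 -scalemxAl mxE mulrC.
have [r|s0 s0E] := @mx_lift0 _ (1%:M - aug F *m u).
  rewrite mulmxBl mul1mx -mulmxA [u *m _]mx11_scalar mul_mx_scalar.
  move: uI => /IE[y yE]; apply/IE; exists (aug F r 0 * y).
  by rewrite !mxE -mulrA -yE mulrBr mulr1 mulrC mxE.
have [|s1 s1E] := @mx_lift 0 _ (1%:M - f *m g - diff F 0 *m s0).
  rewrite !mulmxBl mul1mx -!mulmxA -gE -s0E mulmxBr mulmx1 mulmxA fE.
  by rewrite -scalemxAr -scalemxAl subrr.
(* The Koszul complex stops in degree 1, so [f] must kill the boundaries; regularity of [a] gives
   this. *)
have df0 : diff F 1 *m f = 0.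
  by apply: scale_reg; rewrite scalemxAr -fE mulmxA diff_diff mul0mx.
have [|s2 s2E] := @mx_lift 1 _ (1%:M - diff F 1 *m s1).
  rewrite mulmxBl mul1mx -mulmxA -s1E !mulmxBr mulmx1 !mulmxA df0.
  by rewrite diff_diff !mul0mx !subr0 subrr.
(* Each homotopy map occurs in two consecutive identities. The recursion therefore carries a pair of
   maps with its identity, and the next pair starts with the second map of the previous one. *)
have step i (p : {t : 'M_(rk F i.+1, rk F i.+2) * 'M_(rk F i.+2, rk F i.+3) |
    1%:M = diff F i.+1 *m t.1 + t.2 *m diff F i.+2}) :
  {t : 'M_(rk F i.+2, rk F i.+3) * 'M_(rk F i.+3, rk F i.+4) |
    t.1 = (sval p).2 /\ 1%:M = diff F i.+2 *m t.1 + t.2 *m diff F i.+3}.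
  apply: cid; case: p => [[t1 t2] /= tE].
  have [|t3 t3E] := @mx_lift _ _ (1%:M - diff F i.+2 *m t2).
    rewrite mulmxBl mul1mx -mulmxA.
    have -> : t2 *m diff F i.+2 = 1%:M - diff F i.+1 *m t1.
      by rewrite tE addrC addKr.
    by rewrite mulmxBr mulmx1 mulmxA diff_diff mul0mx subr0 subrr.
  by exists (t2, t3); split=> //=; rewrite -t3E addrC subrK.
have p0 : {t : 'M_(rk F 1, rk F 2) * 'M_(rk F 2, rk F 3) |
    t.1 = s1 /\ 1%:M = diff F 1 *m t.1 + t.2 *m diff F 2}.
  by exists (s1, s2); split=> //=; rewrite -s2E addrC subrK.
pose q := fix q i : {t : 'M_(rk F i.+1, rk F i.+2) * 'M_(rk F i.+2, rk F i.+3) |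
    1%:M = diff F i.+1 *m t.1 + t.2 *m diff F i.+2} :=
  match i with
  | 0 => exist _ (sval p0) (svalP p0).2
  | j.+1 => exist _ (sval (step j (q j))) (svalP (step j (q j))).2
  end.
pose s i : 'M_(rk F i, rk F i.+1) :=
  match i with 0 => s0 | j.+1 => (sval (q j)).1 end.
exists u, f, g, s; split=> //.
  by rewrite /s /= (svalP p0).1 -s1E [RHS]addrC subrK.
move=> i; rewrite {2}/s [q i.+1]/= [sval (exist _ _ _)]/= (svalP (step i (q i))).1.
exact: (svalP (q i)).
Qed.

Lemma ideal_sum (T : Type) (r : seq T) (f : T -> A) :
  (forall t, J (f t)) -> J (\sum_(t <- r) f t).
Proof. by move=> Jf; elim/big_rec: _ => // i x _; apply: JD. Qed.

Lemma ideal_mulmx p q (v : 'rV_p) (X : 'M_(p, q)) j :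
  (forall i, J (v 0 i)) -> J ((v *m X) 0 j).
Proof. by move=> Jv; rewrite mxE; apply: ideal_sum => i; rewrite mulrC; apply: JM. Qed.

Lemma tensor_boundaries_submod i :
  GRing.submod_closed (fun v => `[< tensor_boundaries (F := F) J (i := i) v >]).
Proof.
split=> [|r x y /asboolP[w wE] /asboolP[w' w'E]]; apply/asboolP.
  by exists 0 => j; rewrite mul0mx subrr mxE.
exists (r *: w + w') => j.
rewrite mulmxDl -scalemxAl opprD addrACA -scalerBr.
by rewrite mxE [X in J (X + _)]mxE; apply: JD => //; apply: JM.
Qed.

Lemma tensor_boundaries_cycles i v :
  tensor_boundaries (F := F) J (i := i) v -> tensor_cycles (F := F) J (i := i) v.
Proof.
case: i v => [//|i] v [w wE] j /=.
rewrite -(subrK (w *m diff F i.+1) v) mulmxDl -mulmxA diff_diff mulmx0 addr0.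
exact: ideal_mulmx.
Qed.

(** The homotopy turns a cycle modulo [J] into a boundary modulo [J], up to the term [v *m f *m g]
    in degree 1. There [a] times [v *m f] is [v *m diff F 0 *m aug F], which lies in [J], so
    [v *m f] does too because [a] is regular modulo [J]. *)
Lemma tor_principal_gt0 i :
  (forall y, J (y * a) -> J y) ->
  is_length (tensor_cycles (F := F) J (i := i.+1))
            (tensor_boundaries (F := F) J (i := i.+1)) 0.
Proof.
move=> Ja; apply: is_length0 (@tensor_boundaries_submod i.+1) _ _ _.
- by move=> v vB; apply/asboolP.
- by move=> v /asboolP /tensor_boundaries_cycles.
move=> v vZ; have [u [f [g [s [_ fE s1E sE]]]]] := homotopy_koszul.
exists (v *m s i.+1) => j; case: i v vZ j => [|i] v vZ j.
  have -> : v - v *m s 1%N *m diff F 1 = v *m f *m g + v *m diff F 0 *m s 0%N.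
    apply/eqP; rewrite subr_eq -!mulmxA -addrA -!mulmxDr -s1E.
    by rewrite addrC subrK mulmx1.
  rewrite mxE; apply: JD; apply: ideal_mulmx => //.
  move=> l; rewrite ord1; apply: Ja; rewrite mulrC.
  have -> : a * (v *m f) 0 0 = (v *m diff F 0 *m aug F) 0 0.
    by rewrite -mulmxA fE -scalemxAr [RHS]mxE.
  exact: ideal_mulmx.
have -> : v - v *m s i.+2 *m diff F i.+2 = v *m diff F i.+1 *m s i.+1.
  by apply/eqP; rewrite subr_eq -!mulmxA -mulmxDr -sE mulmx1.
exact: ideal_mulmx.
Qed.

(** The augmentation identifies Tor in degree 0 with the quotient of [A] by [I + J]; its inverse
    sends 1 to [u]. *)
Lemma tensor_boundaries0P v :
  tensor_boundaries (F := F) J (i := 0) v <->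
  exists r, J ((v *m aug F) 0 0 - r * a).
Proof.
have [u [f [g [s [uI fE _ _]]]]] := homotopy_koszul; split=> [[w wE]|[r rE]].
  have /IE[r rE] := diff_aug_mem w; exists r; rewrite -rE.
  have -> : (v *m aug F) 0 0 - (w *m diff F 0 *m aug F) 0 0 =
            ((v - w *m diff F 0) *m aug F) 0 0 by rewrite mulmxBl !mxE.
  exact: ideal_mulmx.
(* Since [t] lies in [J], [v] may be replaced by [v - t *: u], whose augmentation lies in [I] and
   which is thus an exact boundary. *)
pose t := (v *m aug F) 0 0 - r * a.
have [l|w wE] := @mx_lift0 _ (v - t *: u).
  have -> : ((v - t *: u) *m aug F) l 0 =
            (v *m aug F) 0 0 - t * (u *m aug F) 0 0.
    by rewrite ord1 mulmxBl -scalemxAl !mxE.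
  move: uI => /IE[y yE]; apply/IE; exists (r + t * y).
  rewrite [RHS]mulrDl -[t * y * a]mulrA -yE [t * (1 - _)]mulrBr mulr1 addrA.
  by congr (_ - _); rewrite /t addrC subrK.
by exists w => j; rewrite -wE opprB addrC subrK mxE mulrC; apply: JM.
Qed.

(* Tor_0 is A / (I + J), so its length can be read off a filtration of A. *)
Lemma tor_principal0 m (D : nat -> {pred A}) :
  (forall i, 0 \in D i) ->
  (forall i r x y, x \in D i -> y \in D i -> r * x + y \in D i) ->
  (forall i, {subset D i.+1 <= D i}) ->
  (forall x, x \in D 0%N) ->
  (forall x, x \in D m <-> exists r, J (x - r * a)) ->
  (forall i, (i < m)%N -> exists2 x, x \in D i & x \notin D i.+1) ->
  (forall i x y, (i < m)%N -> x \notin D i.+1 -> y \in D i ->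
     exists r, y - r * x \in D m) ->
  is_length (tensor_cycles (F := F) J (i := 0))
            (tensor_boundaries (F := F) J (i := 0)) m.
Proof.
move=> zD lD decD D0 BD strictD uniD.
have sD i j : (i <= j)%N -> {subset D j <= D i}.
  move=> /subnK <-; elim: (j - i)%N => [//|l IH] x xD; exact/IH/decD.
(* The filtration [D] is pulled back along the augmentation. *)
apply: (@is_length_uniserial _ _ _ _ (fun i => [pred v | (v *m aug F) 0 0 \in D i])).
- move=> i; split=> [|r x y]; rewrite !inE /=; first by rewrite mul0mx mxE.
  by move=> xD yD; rewrite mulmxDl -scalemxAl mxE [X in X + _]mxE; apply: lD.
- by move=> i v; rewrite !inE; apply: decD.
- by move=> v; rewrite inE.
- by move=> v; rewrite inE tensor_boundaries0P; split=> /BD.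
- move=> i im; have [y yD ynD] := strictD i im.
  have [u [f [g [s [/IE[t uE] _ _ _]]]]] := homotopy_koszul.
  (* [y *: u] lifts [y] only up to a multiple of [a], which is harmless because such multiples lie
     in [D m]. *)
  have dD : y - ((y *: u) *m aug F) 0 0 \in D m.
    apply/BD; exists (y * t); rewrite -scalemxAl mxE -mulrA -uE.
    by rewrite mulrBr mulr1 subrr.
  exists (y *: u); rewrite inE /=.
    have := lD i (-1) _ _ (sD _ _ (ltnW im) _ dD) yD.
    by rewrite mulN1r opprB subrK.
  apply: contra ynD => zD'.
  by have := lD i.+1 1 _ _ (sD _ _ im _ dD) zD'; rewrite mul1r subrK.
- move=> i x y im; rewrite !inE /= => xnD yD.
  have [r rD] := uniD _ _ _ im xnD yD; exists r.
  apply/tensor_boundaries0P/BD.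
  by rewrite mulmxBl -scalemxAl [X in X \in _]mxE [X in _ + X]mxE [X in _ - X]mxE.
Qed.

End TorPrincipal.

(** * The local ring at a point of the curve *)

Lemma frac_subM_cancel (K : fieldType) (p q p' q' h s : K) :
  s != 0 -> q != 0 -> q' != 0 ->
  p' / q' - h * q / (s * q') * (p / q) = (p' * s - h * p) / (s * q').
Proof. by move=> s0 q0 q'0; field; rewrite ?s0 ?q0 ?q'0. Qed.

Section LocalRingAtPoint.
Variables (k : fieldType) (N : nat) (c : 'I_N -> k).
Implicit Types (x y : local_ring c) (p q : {mpoly k[N]}).

Lemma tofrac_neq0 q : q.@[c] != 0 -> q%:F != 0.
Proof.
by move=> qc; rewrite tofrac_eq0; apply: contraNneq qc => ->; rewrite meval0.
Qed.

Lemma local_valD x y : \val (x + y) = \val x + \val y.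
Proof. exact: raddfD. Qed.

Lemma local_valB x y : \val (x - y) = \val x - \val y.
Proof. exact: raddfB. Qed.

Lemma local_valM x y : \val (x * y) = \val x * \val y.
Proof. exact: (rmorphM (\val : local_ring c -> _)). Qed.

Lemma local_val0 : \val (0 : local_ring c) = 0.
Proof. exact: raddf0. Qed.

Lemma local_fracP x : exists p q, q.@[c] != 0 /\ \val x = p%:F / q%:F.
Proof. exact/asboolP/(valP x). Qed.

Lemma local_frac_ex p q :
  q.@[c] != 0 -> exists x, \val x = p%:F / q%:F.
Proof.
move=> qc; have xr : p%:F / q%:F \in regular_at c by apply/asboolP; exists p, q.
by exists (LocalRing xr).
Qed.

Lemma frac_cross p q p' q' : q.@[c] != 0 -> q'.@[c] != 0 ->
  p%:F / q%:F = p'%:F / q'%:F -> p * q' = p' * q.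
Proof.
move=> /tofrac_neq0 q0 /tofrac_neq0 q'0 /eqP.
by rewrite (eqr_div _ _ q0 q'0) -[_ * q'%:F]tofracM -tofracM tofrac_eq => /eqP.
Qed.

Lemma ext_ideal_principalP d x (a : local_ring c) : \val a = d%:F ->
  ext_ideal c [set p | exists q, p = q * d] x <-> exists y, x = y * a.
Proof.
move=> aE; split=> [[_ [q [[p ->] qc xE]]]|[y ->]].
  have [y yE] := local_frac_ex p qc; exists y; apply: val_inj.
  by rewrite xE local_valM yE aE tofracM mulrAC.
have [p [q [qc yE]]] := local_fracP y; exists (p * d), q; split=> //.
  by exists p.
by rewrite local_valM yE aE tofracM mulrAC.
Qed.

Variables (phi : {rmorphism {mpoly k[N]} -> {poly k}}) (x0 : k).
Hypotheses (phi_eval : forall q, (phi q).[x0] = q.@[c])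
  (phi_surj : forall g, exists p, phi p = g).

Let J := ext_ideal c [set p | phi p = 0].

(** Membership does not depend on the fraction: cross-multiply and apply [phi], which sends an
    admissible denominator to a nonzero polynomial, its value at [x0] being nonzero. *)
Lemma ext_kerP x p q : q.@[c] != 0 -> \val x = p%:F / q%:F ->
  J x <-> phi p = 0.
Proof.
move=> qc xE; split=> [[p' [q' [p'0 q'c]]]|p0]; last by exists p, q.
rewrite xE => /(frac_cross qc q'c) /(congr1 phi); rewrite !rmorphM p'0 mul0r.
move=> /eqP; rewrite mulf_eq0 => /orP[/eqP //|/eqP q'0].
by move: q'c; rewrite -phi_eval q'0 horner0 eqxx.
Qed.

Lemma ext_ker0 : J 0.
Proof.
by exists 0, 1; rewrite /= rmorph0 meval1 oner_neq0 tofrac0 mul0r.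
Qed.

Lemma ext_kerD x y : J x -> J y -> J (x + y).
Proof.
move=> [p [q [p0 qc xE]]] [p' [q' [p'0 q'c yE]]].
exists (p * q' + p' * q), (q * q'); split.
- by rewrite /= rmorphD !rmorphM p0 p'0 !mul0r addr0.
- by rewrite mevalM mulf_neq0.
- by rewrite local_valD xE yE addf_div ?tofrac_neq0 // tofracD !tofracM.
Qed.

Lemma ext_kerM x y : J y -> J (x * y).
Proof.
have [p [q [qc xE]]] := local_fracP x; move=> [p' [q' [p'0 q'c yE]]].
exists (p * p'), (q * q'); split.
- by rewrite /= rmorphM p'0 mulr0.
- by rewrite mevalM mulf_neq0.
- by rewrite local_valM xE yE mulf_div !tofracM.
Qed.

(** Inherited from the domain [{poly k}]; it makes the equation of the hypersurface regular modulo
    [J]. *)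
Lemma ext_ker_prime x y : J (x * y) -> J x \/ J y.
Proof.
have [p [q [qc xE]]] := local_fracP x; have [p' [q' [q'c yE]]] := local_fracP y.
have xyE : \val (x * y) = (p * p')%:F / (q * q')%:F.
  by rewrite local_valM xE yE mulf_div !tofracM.
rewrite (ext_kerP _ xyE) ?mevalM ?mulf_neq0 // (ext_kerP qc xE) (ext_kerP q'c yE).
by rewrite rmorphM => /eqP; rewrite mulf_eq0 => /orP[]/eqP; [left|right].
Qed.

(* The filtration of the local ring induced, through the curve, by the order
   of vanishing at x0. *)
Definition vanishing_order (i : nat) : {pred local_ring c} := fun x =>
  `[< exists p q, [/\ q.@[c] != 0, \val x = p%:F / q%:F
                    & ('X - x0%:P) ^+ i %| phi p] >].

Lemma coprime_XsubC_exp i (g : {poly k}) :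
  g.[x0] != 0 -> coprimep (('X - x0%:P) ^+ i) g.
Proof. by move=> gx; rewrite coprimep_expl // coprimep_sym coprimep_XsubC rootE. Qed.

(** The order does not depend on the fraction, because [phi] sends denominators to polynomials prime
    to ['X - x0%:P]. *)
Lemma vanishing_orderE i x p q : q.@[c] != 0 -> \val x = p%:F / q%:F ->
  (x \in vanishing_order i) = (('X - x0%:P) ^+ i %| phi p).
Proof.
move=> qc xE; apply/asboolP/idP => [[p' [q' [q'c xE' dv]]]|dv]; last by exists p, q.
move: xE'; rewrite xE => /(frac_cross qc q'c) /(congr1 phi); rewrite !rmorphM => e.
have co : coprimep (('X - x0%:P) ^+ i) (phi q').
  by apply: coprime_XsubC_exp; rewrite phi_eval.
by rewrite -(Gauss_dvdpl _ co) e dvdp_mulr.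
Qed.

Lemma vanishing_order_S i :
  {subset vanishing_order i.+1 <= vanishing_order i}.
Proof.
move=> x /asboolP[p [q [qc xE dv]]]; rewrite (vanishing_orderE _ qc xE).
by apply: dvdp_trans dv; rewrite exprS dvdp_mull.
Qed.

Lemma vanishing_order_0 x : x \in vanishing_order 0.
Proof.
have [p [q [qc xE]]] := local_fracP x.
by rewrite (vanishing_orderE _ qc xE) expr0 dvd1p.
Qed.

Lemma ker_vanishing_order i x : J x -> x \in vanishing_order i.
Proof.
by move=> [p [q [p0 qc xE]]]; rewrite (vanishing_orderE _ qc xE) p0 dvdp0.
Qed.

Lemma vanishing_order_lin i r x y :
  x \in vanishing_order i -> y \in vanishing_order i ->
  r * x + y \in vanishing_order i.
Proof.
have [pr [qr [qrc rE]]] := local_fracP r.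
move=> /asboolP[p [q [qc xE dv]]] /asboolP[p' [q' [q'c yE dv']]].
apply/asboolP; exists (pr * p * q' + p' * (qr * q)), (qr * q * q'); split.
- by rewrite !mevalM !mulf_neq0.
- rewrite local_valD local_valM rE xE yE mulf_div addf_div ?mulf_neq0 ?tofrac_neq0 //.
  by rewrite tofracD !tofracM.
- by rewrite rmorphD !rmorphM dvdp_add ?(dvdp_mulr _ dv') // dvdp_mulr // dvdp_mull.
Qed.

Lemma vanishing_order_strict i :
  exists2 x, x \in vanishing_order i & x \notin vanishing_order i.+1.
Proof.
have [p pE] := phi_surj (('X - x0%:P) ^+ i).
have c1 : (1 : {mpoly k[N]}).@[c] != 0 by rewrite meval1 oner_neq0.
have [x xE] := local_frac_ex p c1; exists x; rewrite (vanishing_orderE _ c1 xE) pE.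
  exact: dvdpp.
by rewrite dvdp_Pexp2l ?size_XsubC // ltnn.
Qed.

(** Modulo [J] the local ring is the discrete valuation ring of [{poly k}] at [x0], where an element
    of order at most [i] divides every element of order at least [i]. *)
Lemma vanishing_order_divide i x y :
  x \notin vanishing_order i.+1 -> y \in vanishing_order i ->
  exists r, J (y - r * x).
Proof.
have [p [q [qc xE]]] := local_fracP x; rewrite (vanishing_orderE _ qc xE) => xn.
move=> /asboolP[p' [q' [q'c yE dv]]].
have p0 : phi p != 0 by apply: contraNneq xn => ->; rewrite dvdp0.
have [e [g gx pE]] := multiplicity_XsubC (phi p) x0.
rewrite p0 /= in gx.
have le_ei : (e <= i)%N.
  by rewrite leqNgt; apply: contra xn => lt_ie; rewrite pE dvdp_mull // dvdp_exp2l.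
have [g' p'E] : exists g', phi p' = g' * ('X - x0%:P) ^+ e.
  have /dvdpP[g' ->] := dvdp_trans (dvdp_exp2l ('X - x0%:P) le_ei) dv.
  by exists g'.
have [[s sE] [h hE]] := (phi_surj g, phi_surj g').
have sc : s.@[c] != 0 by rewrite -phi_eval sE.
have sqc : (s * q').@[c] != 0 by rewrite mevalM mulf_neq0.
(* With [e] the order of [phi p], the cofactors [g] and [g'] of [phi p] and [phi p'] lift to [s] and
   [h]. The quotient is [h * q / (s * q')], and [p' * s - h * p] maps to 0 under [phi]. *)
have [r rE] := local_frac_ex (h * q) sqc; exists r.
exists (p' * s - h * p), (s * q'); split=> //.
  rewrite /= rmorphB !rmorphM sE hE pE p'E.
  by rewrite mulrAC mulrA subrr.
rewrite local_valB local_valM rE xE yE tofracB !tofracM.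
have [[s0 q0] q'0] := (tofrac_neq0 sc, tofrac_neq0 qc, tofrac_neq0 q'c).
exact: (frac_subM_cancel p%:F p'%:F h%:F s0 q0 q'0).
Qed.

Variables (d : {mpoly k[N]}).
Hypothesis phi_d : phi d != 0.

Let I := ext_ideal c [set p | exists q, p = q * d].

Lemma local_poly_ex : exists a : local_ring c, \val a = d%:F.
Proof.
have [|a aE] := @local_frac_ex d 1; first by rewrite meval1 oner_neq0.
by exists a; rewrite aE tofrac1 divr1.
Qed.

(** Only Tor in degree 0 contributes to the alternating sum, and the filtration by vanishing order,
    cut at the order [m] of [phi d], computes its length. *)
Lemma intersection_mult_curve :
  intersection_mult_finite [set p | exists q, p = q * d] [set p | phi p = 0] c /\
  intersection_mult [set p | exists q, p = q * d] [set p | phi p = 0] c =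
    (mup x0 (phi d))%:Z.
Proof.
have [a aE] := local_poly_ex.
have IE x := ext_ideal_principalP x aE.
have c1 : (1 : {mpoly k[N]}).@[c] != 0 by rewrite meval1 oner_neq0.
have aE1 : \val a = d%:F / (1 : {mpoly k[N]})%:F by rewrite tofrac1 divr1.
have d0 : d != 0 by apply: contraNneq phi_d => ->; rewrite rmorph0.
have a_reg y : y * a = 0 -> y = 0.
  move=> /(congr1 val); rewrite local_valM aE local_val0 => /eqP.
  rewrite mulf_eq0 tofrac_eq0 (negPf d0) orbF => /eqP y0.
  by apply: val_inj; rewrite y0 local_val0.
have Ja y : J (y * a) -> J y.
  by move=> /ext_ker_prime[//|/(ext_kerP c1 aE1)/eqP]; rewrite (negPf phi_d).
set m := mup x0 (phi d).
have a_in : a \in vanishing_order m.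
  by rewrite (vanishing_orderE _ c1 aE1) -mup_geq.
have a_nin : a \notin vanishing_order m.+1.
  by rewrite (vanishing_orderE _ c1 aE1) -mup_geq // ltnn.
have vo0 i : 0 \in vanishing_order i.
  exact: ker_vanishing_order ext_ker0.
have tor0 := tor_principal0 IE a_reg ext_ker0 ext_kerD ext_kerM vo0
  vanishing_order_lin vanishing_order_S vanishing_order_0 (m := m).
have {}tor0 : is_length
    (tensor_cycles (F := resolution I) J (i := 0))
    (tensor_boundaries (F := resolution I) J (i := 0)) m.
  apply: tor0 => [x|i _|i x y _ xn yD].
  (* Since [a] has order exactly [m], it divides modulo [J] every element of order at least [m]. *)
  - split=> [xD|[r /(ker_vanishing_order m) xr]].
      exact: vanishing_order_divide a_nin xD.
    by rewrite -(subrK (r * a) x) addrC vanishing_order_lin.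
  - exact: vanishing_order_strict.
  - have [r /(ker_vanishing_order m) rD] := vanishing_order_divide xn yD.
    by exists r.
have torS i := tor_principal_gt0 IE a_reg ext_ker0 ext_kerD ext_kerM i Ja.
split=> [[|i] _|]; [by exists m|by exists 0%N; apply: torS|].
rewrite /intersection_mult big_ord_recl expr0 mul1r big1 ?addr0; last first.
  by move=> i _; rewrite /tor_length (mod_lengthP (torS _)) mulr0.
by rewrite /tor_length (mod_lengthP tor0).
Qed.

End LocalRingAtPoint.

(** * Degree and top coefficient of a determinant of polynomials *)

Section DeterminantDegree.
Variable R : comNzRingType.
Implicit Types (p q : {poly R}).

(** In the convolution, an index above [a] kills the factor from [p], and one below [a] kills the
    factor from [q]. *)
Lemma coefM_top p q a b : (size p <= a.+1)%N -> (size q <= b.+1)%N ->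
  (p * q)`_(a + b) = p`_a * q`_b.
Proof.
move=> pa qb; have lt_a : (a < (a + b).+1)%N by rewrite ltnS leq_addr.
rewrite coefM (bigD1 (Ordinal lt_a)) //= addKn big1 ?addr0 // => i.
rewrite -val_eqE neq_ltn /= => /orP[ia|ai]; last first.
  by rewrite nth_default ?mul0r // (leq_trans pa).
rewrite [q`__]nth_default ?mulr0 // (leq_trans qb) //.
by rewrite ltn_subRL ltn_add2r.
Qed.

Lemma size_prod_bound n (F : 'I_n -> {poly R}) d :
  (forall i, (size (F i) <= d.+1)%N) -> (size (\prod_i F i)%R <= (d * n).+1)%N.
Proof.
elim: n F => [|n IH] F Fd; first by rewrite big_ord0 size_poly1.
rewrite big_ord_recr /=; apply: leq_trans (size_polyMleq _ _) _.
rewrite -subn1 leq_subLR add1n mulnS addnC -addnS -addSn.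
by rewrite leq_add ?IH.
Qed.

Lemma coef_prod_top n (F : 'I_n -> {poly R}) d :
  (forall i, (size (F i) <= d.+1)%N) ->
  (\prod_i F i)`_(d * n) = \prod_i (F i)`_d.
Proof.
elim: n F => [|n IH] F Fd; first by rewrite !big_ord0 muln0 coef1.
by rewrite !big_ord_recr /= mulnS addnC coefM_top ?IH // size_prod_bound.
Qed.

Lemma size_det_bound n (M : 'M[{poly R}]_n) d :
  (forall i j, (size (M i j) <= d.+1)%N) -> (size (\det M)%R <= (d * n).+1)%N.
Proof.
move=> Md; apply: leq_trans (size_sum _ _ _) _; apply/bigmax_leqP => s _.
by rewrite mulr_sign; case: ifP => _; rewrite ?size_polyN size_prod_bound.
Qed.

Lemma coef_det_top n (M : 'M[{poly R}]_n) d :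
  (forall i j, (size (M i j) <= d.+1)%N) ->
  (\det M)`_(d * n) = \det (map_mx (fun p => p`_d) M).
Proof.
move=> Md; rewrite coef_sum; apply: eq_bigr => s _.
rewrite !mulr_sign; case: ifP => _; rewrite ?coefN coef_prod_top //.
  by congr (- _); apply: eq_bigr => i _; rewrite mxE.
by apply: eq_bigr => i _; rewrite mxE.
Qed.

End DeterminantDegree.

(** * Root multiplicities over an algebraically closed field *)

Section SumOfMultiplicities.
Variable k : closedFieldType.

Lemma sum_mup (p : {poly k}) : p != 0 ->
  \sum_(x \in [set x | root p x]) (mup x p)%:Z = ((size p).-1)%:Z.
Proof.
move=> p0; have [r pE] := closed_field_poly_normal p.
have lp : lead_coef p != 0 by rewrite lead_coef_eq0.
have -> : [set x | root p x] = [set` undup r].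
  by apply/seteqP; split=> x /=; rewrite mem_undup {1}pE rootZ // root_prod_XsubC.
rewrite -fsbig_seq ?undup_uniq // {2}pE size_scale // size_prod_XsubC /=.
have mE x : mup x p = count_mem x r.
  rewrite pE -mul_polyC mupMr ?mu_prod_XsubC //.
  by rewrite rootE hornerC.
(* Each multiplicity is written as an iterated sum of ones, so that the sum over distinct roots
   becomes a sum of ones over [r] with repetitions. *)
rewrite (eq_bigr (fun x => iterop (count_mem x r) +%R (1 : int) 0)) => [|x _].
  by rewrite big_undup_iterop_count big_const_seq count_predT iter_addr_0 natz.
by rewrite mE -natz.
Qed.

End SumOfMultiplicities.

(** * The comorphism, spectrum and point at infinity of the curve *)

Section Curve.
Variables (k : fieldType) (n : nat) (L : 'M[{poly k}]_n).

Lemma curve_comorphism_eval q x :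
  (curve_comorphism L q).[x] = q.@[point_of_mx (curve_at L x)].
Proof.
rewrite /curve_comorphism /meval /mmap horner_sum; apply: eq_bigr => m _.
rewrite hornerM hornerC /mmap1 horner_prod; congr (_ * _).
apply: eq_bigr => i _; rewrite horner_exp /point_of_mx /curve_at.
by rewrite -map_mxvec mxE.
Qed.

Lemma curve_comorphism_det : curve_comorphism L (\det (@generic_mx k n)) = \det L.
Proof.
rewrite /curve_comorphism -det_map_mx map_vec_mx -[in RHS](mxvecK L).
congr (\det (vec_mx _)); apply/rowP => i.
by rewrite !mxE /= mmapX mmap1U.
Qed.

(** The image of the comorphism is a subalgebra containing the entries of [L], so admissibility
    forces it to be everything. *)
Lemma curve_comorphism_surj :
  admissible L -> forall g, exists p, curve_comorphism L p = g.
Proof.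
move=> Ladm g; apply/asboolP.
apply: (Ladm (fun g => `[< exists p, curve_comorphism L p = g >])).
  split=> [|a u v /asboolP[p <-] /asboolP[q <-]|u v /asboolP[p <-] /asboolP[q <-]];
    apply/asboolP.
  - by exists 1; rewrite /curve_comorphism rmorph1.
  - by exists (a *: p + q); rewrite /curve_comorphism rmorphD /= mmapZ mul_polyC.
  - by exists (p * q); rewrite /curve_comorphism rmorphM.
move=> i j; apply/asboolP; exists ('X_(mxvec_index i j)).
by rewrite /curve_comorphism mmapX mmap1U mxvecE.
Qed.

Lemma spectrumE : spectrum L = [set x | root (\det L) x].
Proof.
have detE x : \det (curve_at L x) = (\det L).[x].
  exact: (det_map_mx (horner_eval x) L).
by apply/seteqP; split=> x; rewrite /spectrum /= detE rootE => /eqP.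
Qed.

Lemma curve_degreeP i j : (size (L i j) <= (curve_degree L).+1)%N.
Proof.
rewrite (leq_trans (leqSpred _)) // ltnS.
exact: (leq_trans (leq_bigmax j) (leq_bigmax (F := fun i => \max_j _) i)).
Qed.

(** At [b = 0] only the summand with [l = d] survives, thanks to [0 ^+ 0 = 1]. *)
Lemma proj_curve_infinity :
  (proj_curve L 1 0).2 = map_mx (fun p : {poly k} => p`_(curve_degree L)) L.
Proof.
apply/matrixP => i j; rewrite !mxE big_ord_recr /= subnn big1 => [|l _].
  by rewrite add0r expr1n !mulr1.
by rewrite expr0n subn_eq0 leqNgt ltn_ord mulr0.
Qed.

End Curve.

Theorem theorem2p2 (k : closedFieldType) (n : nat) (hn : (0 < n)%N)
    (L : 'M[{poly k}]_n) (hL : admissible L)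
    (hproj : Some @` spectrum L = proj_spectrum L)
    (hspec : spectrum L <> [set: k]) :
  let mult (x : k) : int :=
    intersection_mult (@singular_ideal k n) (curve_ideal L)
      (point_of_mx (curve_at L x)) in
  [/\ forall x, spectrum L x ->
        intersection_mult_finite (@singular_ideal k n) (curve_ideal L)
          (point_of_mx (curve_at L x)),
      \sum_(x \in spectrum L) (alg_mult L x)%:Z =
        \sum_(x \in spectrum L) mult x
    & \sum_(x \in spectrum L) mult x = (curve_degree L * n)%N%:Z].
Proof.
move=> mult; have detL0 : \det L != 0.
  apply: contra_notN hspec => /eqP dL.
  by rewrite spectrumE dL; apply/seteqP; split=> // x _ /=; rewrite root0.
(* This local equality holds at every [x]; off the spectrum both multiplicities are 0. *)
have multE x : intersection_mult_finite (@singular_ideal k n) (curve_ideal L)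
    (point_of_mx (curve_at L x)) /\ mult x = (alg_mult L x)%:Z.
  rewrite /mult /alg_mult -curve_comorphism_det.
  apply: (@intersection_mult_curve _ _ _ (mmap polyC (fun i => mxvec L 0 i))).
  - by move=> q; apply: curve_comorphism_eval.
  - exact: curve_comorphism_surj.
  - by have := detL0; rewrite -{1}curve_comorphism_det.
have degL : (size (\det L)).-1 = (curve_degree L * n)%N.
  apply/eqP; rewrite eqn_leq; apply/andP; split.
    have := size_det_bound (@curve_degreeP _ _ L).
    by case: (size _).
  (* This coefficient is the determinant at infinity. Were it 0, [None] would lie in the projective
     spectrum, which by [hproj] contains only finite points. *)
  have : (\det L)`_(curve_degree L * n) != 0.
    rewrite (coef_det_top (@curve_degreeP _ _ L)) -proj_curve_infinity.
    apply/negP => /eqP dinf.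
    have : proj_spectrum L None by [].
    by rewrite -hproj => -[].
  apply: contraNleq => lt; rewrite nth_default //.
  by case: (size _) lt.
have sumE : \sum_(x \in spectrum L) (alg_mult L x)%:Z =
    (curve_degree L * n)%N%:Z.
  by rewrite spectrumE sum_mup // degL.
have sum_mult : \sum_(x \in spectrum L) (alg_mult L x)%:Z =
    \sum_(x \in spectrum L) mult x.
  by apply: eq_fsbigr => x _; rewrite (multE x).2.
split=> [x _||]; [exact: (multE x).1|exact: sum_mult|by rewrite -sum_mult].
Qed.
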